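(* Let $m=\prod_{i=1}^t p_i^{\alpha_i}$ with distinct primes $p_i$, and let $X\in\mathbb{N}[C_m]$ be a $v$-sum with $c$-exponent $k$. Then $k$ is square-free; more precisely $k=\prod_{i\in I}p_i$ for some $I\subseteq\{1,\dots,t\}$.
   Context: $C_m$ is the multiplicative cyclic group of order $m$ with generator $g$, and $\mathbb{N}[C_m]$ is the set of group ring elements with nonnegative integer coefficients. An element $X=\sum_{i=1}^m a_ig^i\in\mathbb{N}[C_m]$ is a $v$-sum if $\sum_i a_i\zeta_m^i=0$, where $\zeta_m$ is a primitive $m$-th root of unity. It is a minimal $v$-sum if there is no $Y=\sum b_ig^i\ne 0$ with $0\le b_i\le a_i$ for all $i$, $b_j<a_j$ for some $j$, and $Y$ a $v$-sum. For a sum $\sum_{i\in I}a_i\eta_i$ of roots of unity with positive coefficients, the reduced exponent is the smallest positive integer $r$ such that for some $j\in I$, $(\eta_i\eta_j^{-1})^r=1$ for all $i\in I$; the reduced exponent of a minimal $v$-sum $X=\sum a_ig^i$ is that of $\sum a_i\zeta_m^i$. Every $v$-sum $X$ can be written as a sum $X=\sum_i X_i$ of minimal $v$-sums; for such a decomposition, the reduced exponent of $X$ with respect to it is the lcm of the reduced exponents of the $X_i$. The $c$-exponent of $X$ is the smallest such reduced exponent over all decompositions of $X$ into minimal $v$-sums. *)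

(* Defs.v *)
From HB Require Import structures.
From mathcomp Require Import all_boot all_order all_algebra all_field.

Set Implicit Arguments.
Unset Strict Implicit.
Unset Printing Implicit Defensive.

Import Order.TTheory GRing.Theory Num.Theory.
Local Open Scope ring_scope.

(* X : ngring m stands for \sum_(i < m) (X i) g^i in N[C_m]; the exponents are
   the representatives 0, ..., m - 1 of the integers mod m. *)
Notation ngring m := {ffun 'I_m -> nat}.

Definition least (P : nat -> Prop) (n : nat) : Prop :=
  P n /\ forall k, P k -> (n <= k)%N.

Definition vsum (m : nat) (zeta : algC) (X : ngring m) : Prop :=
  \sum_(i < m) (X i)%:R * zeta ^+ i = 0.

Definition minimal_vsum (m : nat) (zeta : algC) (X : ngring m) : Prop :=
  vsum zeta X /\
  ~ (exists Y : ngring m,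
       [/\ Y <> 0,
           forall i, (Y i <= X i)%N,
           exists j, (Y j < X j)%N
         & vsum zeta Y]).

(* The sum is \sum_(i : T | 0 < a i) a i * eta i: terms with coefficient 0 do
   not occur in it.  The empty sum has no reduced exponent. *)
Definition reduced_exponent (T : finType) (a : T -> nat) (eta : T -> algC) :
    nat -> Prop :=
  least (fun r => (0 < r)%N /\
    exists2 j, (0 < a j)%N &
      forall i, (0 < a i)%N -> (eta i * (eta j)^-1) ^+ r = 1).

Definition vsum_reduced_exponent (m : nat) (zeta : algC) (X : ngring m) :
    nat -> Prop :=
  reduced_exponent X (fun i : 'I_m => zeta ^+ i).

(* The parts are nonzero: 0 satisfies minimal_vsum vacuously, but it has no
   reduced exponent.  The decomposition of X = 0 is the empty one. *)
Definition decomposition (m : nat) (zeta : algC) (X : ngring m)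
    (n : nat) (Y : 'I_n -> ngring m) : Prop :=
  X = \sum_(i < n) Y i /\ forall i, Y i <> 0 /\ minimal_vsum zeta (Y i).

Definition decomposition_exponent (m : nat) (zeta : algC)
    (n : nat) (Y : 'I_n -> ngring m) (e : nat) : Prop :=
  exists2 r : 'I_n -> nat,
    forall i, vsum_reduced_exponent zeta (Y i) (r i) &
    e = \big[lcmn/1%N]_(i < n) r i.

Definition c_exponent (m : nat) (zeta : algC) (X : ngring m) : nat -> Prop :=
  least (fun e => exists (n : nat) (Y : 'I_n -> ngring m),
    decomposition zeta X Y /\ decomposition_exponent zeta Y e).

Definition squarefree (n : nat) : Prop :=
  forall d : nat, (d ^ 2 %| n)%N -> d = 1%N.

(* Main.v *)
(** The key point is that the reduced exponent [r] of a minimal [v]-sum is not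
    divisible by the square of any prime [p].  Normalise one term of the sum
    to be [1], so that all terms are [r]-th roots of unity.  If [p ^ 2]
    divides [r], then [1 + s * (r / p)] is prime to [r] for all [s], so it
    defines a Galois automorphism.  Averaging the [p] conjugates of the sum
    over [s < p] kills exactly the terms [eta] with [eta ^ (r / p) != 1];
    what remains is a vanishing subsum containing [1], hence by minimality
    the whole sum, so that [r / p] already annihilates all terms. *)
Require Import Defs.
From HB Require Import structures.
From mathcomp Require Import all_boot all_order all_algebra all_field.

Set Implicit Arguments.
Unset Strict Implicit.
Unset Printing Implicit Defensive.

Import Order.TTheory GRing.Theory Num.Theory.
Local Open Scope ring_scope.

Lemma sum_unity_root_powers (R : idomainType) (n : nat) (x : R) :
  x ^+ n = 1 -> \sum_(s < n) x ^+ s = if x == 1 then n%:R else 0.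
Proof.
move=> xn1; case: eqVneq => [-> | x_neq1].
  by under eq_bigr do rewrite expr1n; rewrite sumr_const card_ord.
have /esym/eqP := subrX1 x n.
by rewrite xn1 subrr mulf_eq0 subr_eq0 (negPf x_neq1) => /eqP.
Qed.

(** Since [p ^ 2] divides [r], every prime factor of [r], including [p], still divides [r %/ p], and
    the number is 1 modulo each of them. *)
Lemma coprime_succ_mul_div (r p s : nat) :
  prime p -> (p ^ 2 %| r)%N -> coprime (s * (r %/ p)).+1 r.
Proof.
move=> p_pr /dvdnP[q ->]; rewrite expnS expn1 mulnA mulnK ?prime_gt0 //.
have co_qp : coprime (s * (q * p)).+1 (q * p).
  by rewrite coprime_sym; apply: coprime_dvdl (coprimenS _); apply: dvdn_mull.
by rewrite coprimeMr co_qp; move: co_qp; rewrite coprimeMr => /andP[].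
Qed.

Lemma vanishing_subsum_of_square_dvd (T : finType) (a : T -> nat)
    (eta : T -> algC) (r p : nat) :
    prime p -> (p ^ 2 %| r)%N ->
    (forall i, (0 < a i)%N -> eta i ^+ r = 1) ->
    \sum_i (a i)%:R * eta i = 0 ->
  \sum_(i | eta i ^+ (r %/ p) == 1) (a i)%:R * eta i = 0.
Proof.
move=> p_pr p2r eta_r sum0.
have pr : (p %| r)%N by apply: dvdn_trans p2r; apply: dvdn_exp.
have conj0 s : \sum_i (a i)%:R * eta i * (eta i ^+ (r %/ p)) ^+ s = 0.
  (* [u] raises [r]-th roots of unity to the power [s * (r %/ p) + 1], so it multiplies [eta i] by
     [(eta i ^+ (r %/ p)) ^+ s] whenever [0 < a i]. *)
  have [u uE] := Qn_aut_exists (coprime_succ_mul_div s p_pr p2r).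
  have := congr1 u sum0; rewrite rmorph0 rmorph_sum => {2}<- /=.
  apply: eq_bigr => i _; rewrite rmorphM rmorph_nat.
  have [->|a_gt0] := posnP (a i); first by rewrite !mul0r.
  by rewrite uE ?eta_r // exprS mulrA -exprM [(s * _)%N]mulnC.
have : \sum_(s < p) \sum_i (a i)%:R * eta i * (eta i ^+ (r %/ p)) ^+ s = 0.
  by rewrite big1.
rewrite exchange_big /=; under eq_bigr => i _ do rewrite -mulr_sumr.
have -> : \sum_i (a i)%:R * eta i * (\sum_(s < p) (eta i ^+ (r %/ p)) ^+ s)
    = (\sum_(i | eta i ^+ (r %/ p) == 1) (a i)%:R * eta i) * p%:R.
  rewrite mulr_suml [RHS]big_mkcond; apply: eq_bigr => i _.
  have [->|a_gt0] := posnP (a i); first by rewrite !mul0r if_same.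
  (* [eta i ^+ (r %/ p)] is a [p]-th root of unity, so its powers add up to [p] or to 0. *)
  rewrite sum_unity_root_powers; last by rewrite -exprM divnK ?eta_r.
  by case: eqP; rewrite ?mulr0.
move/eqP; rewrite mulf_eq0 pnatr_eq0 [p == 0%N]eqn0Ngt prime_gt0 // orbF.
by move/eqP.
Qed.

Lemma minimal_vsum_reduced_exponent_logn (m : nat) (zeta : algC)
    (X : ngring m) (r q : nat) :
    zeta != 0 -> minimal_vsum zeta X -> vsum_reduced_exponent zeta X r ->
  (logn q r <= 1)%N.
Proof.
move=> z_neq0 [X0 minX] [[r_gt0 [j Xj eta_r]] least_r].
have [p_pr | q_npr] := boolP (prime q); last by rewrite lognE (negPf q_npr).
rewrite leqNgt; apply/negP => q2; have {q2} p2r : (q ^ 2 %| r)%N.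
  by rewrite pfactor_dvdn.
pose eta (i : 'I_m) : algC := zeta ^+ i * (zeta ^+ j)^-1.
have zj_neq0 : zeta ^+ j != 0 by rewrite expf_neq0.
have etaK (i : 'I_m) : zeta ^+ i = eta i * zeta ^+ j by rewrite /eta mulfVK.
have sum0 : \sum_i (X i)%:R * eta i = 0.
  by under eq_bigr do rewrite /eta mulrA; rewrite -mulr_suml X0 mul0r.
have sub0 := vanishing_subsum_of_square_dvd p_pr p2r eta_r sum0.
(* [Y] collects the terms that survive the averaging. It contains the term [j], where [eta j = 1],
   and multiplying [sub0] by [zeta ^+ j] shows that it is a [v]-sum; a term of [X] outside it would
   contradict minimality. *)
pose Y : ngring m := [ffun i => if eta i ^+ (r %/ q) == 1 then X i else 0%N].
have qr : (q %| r)%N by apply: dvdn_trans p2r; apply: dvdn_exp.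
have eta_rq i : (0 < X i)%N -> eta i ^+ (r %/ q) = 1.
  move=> Xi; apply/eqP/negPn/negP => eta_i; apply: minX; exists Y; split.
  - move/ffunP/(_ j); rewrite !ffunE /eta mulfV // expr1n eqxx => Xj0.
    by rewrite Xj0 in Xj.
  - by move=> l; rewrite ffunE; case: ifP.
  - by exists i; rewrite ffunE (negPf eta_i).
  rewrite /vsum; under eq_bigr => l _ do rewrite etaK mulrA.
  rewrite -mulr_suml; apply/eqP; rewrite mulf_eq0 (negPf zj_neq0) orbF.
  apply/eqP; rewrite -[RHS]sub0 [RHS]big_mkcond; apply: eq_bigr => l _.
  by rewrite ffunE; case: ifP; rewrite ?mul0r.
have rq_gt0 : (0 < r %/ q)%N by rewrite divn_gt0 ?prime_gt0 // dvdn_leq.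
suff : (r <= r %/ q)%N by rewrite leqNgt ltn_Pdiv ?prime_gt1.
by apply: least_r; split=> //; exists j.
Qed.

(** All quotients of terms are [m]-th roots of unity, so an exponent [r] that kills them can be
    replaced by [gcdn r m]; leastness then forces [r = gcdn r m]. *)
Lemma vsum_reduced_exponent_dvd (m : nat) (zeta : algC) (X : ngring m)
    (r : nat) :
  m.-primitive_root zeta -> vsum_reduced_exponent zeta X r -> (r %| m)%N.
Proof.
move=> z_prim [[r_gt0 [j Xj eta_r]] least_r].
have m_gt0 := prim_order_gt0 z_prim.
suff /least_r : (0 < gcdn r m)%N /\ exists2 j : 'I_m, (0 < X j)%N &
    forall i : 'I_m, (0 < X i)%N ->
      (zeta ^+ i * (zeta ^+ j)^-1) ^+ gcdn r m = 1.
  by move=> le_r; apply/gcdn_idPl/eqP; rewrite eqn_leq le_r dvdn_leq ?dvdn_gcdl.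
split; first by rewrite gcdn_gt0 r_gt0.
exists j => // i /eta_r eta_i.
have eta_m : (zeta ^+ i * (zeta ^+ j)^-1) ^+ m = 1.
  rewrite exprMn exprVn -!exprM ![(_ * m)%N]mulnC !exprM.
  by rewrite (prim_expr_order z_prim) !expr1n invr1 mulr1.
(* The exact order [d] of the quotient divides both [m] and [r], hence their gcd. *)
have [d d_prim dm] := prim_order_exists m_gt0 eta_m.
by apply/eqP; rewrite -(prim_order_dvd d_prim) dvdn_gcd dm
  (prim_order_dvd d_prim) eta_i eqxx.
Qed.

Lemma logn_prod (I : Type) (s : seq I) (P : pred I) (F : I -> nat) (q : nat) :
    (forall i, P i -> 0 < F i)%N ->
  logn q (\prod_(i <- s | P i) F i) = (\sum_(i <- s | P i) logn q (F i))%N.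
Proof.
(* Positivity is carried through the induction because [logn] is additive only on positive
   factors. *)
move=> F_gt0; suff [] : (0 < \prod_(i <- s | P i) F i)%N /\
  logn q (\prod_(i <- s | P i) F i) = (\sum_(i <- s | P i) logn q (F i))%N by [].
elim/big_rec2: _ => [|i n e Pi [e_gt0 <-]]; first by rewrite logn1.
by rewrite muln_gt0 F_gt0 // lognM ?F_gt0.
Qed.

Lemma logn_biglcm_le (n : nat) (r : 'I_n -> nat) (q e : nat) :
    (forall i, 0 < r i)%N -> (forall i, logn q (r i) <= e)%N ->
  (logn q (\big[lcmn/1%N]_(i < n) r i) <= e)%N.
Proof.
move=> r_gt0 r_le; suff [] : (0 < \big[lcmn/1%N]_(i < n) r i)%N /\
  (logn q (\big[lcmn/1%N]_(i < n) r i) <= e)%N by [].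
elim/big_ind: _ => // [|x y [x_gt0 x_le] [y_gt0 y_le]]; first by rewrite logn1.
by rewrite lcmn_gt0 x_gt0 y_gt0 logn_lcm // geq_max x_le.
Qed.

Lemma squarefree_logn_le1 (k : nat) :
  (0 < k)%N -> (forall q, logn q k <= 1)%N -> squarefree k.
Proof.
move=> k_gt0 k_le1 d d2k.
have d_gt0 : (0 < d)%N by case: d d2k => //; rewrite dvd0n; case: k k_gt0 {k_le1}.
apply/eqP; rewrite eqn_leq d_gt0 leqNgt andbT; apply/negP => /pdivP[q q_pr qd].
have := k_le1 q; rewrite leqNgt -pfactor_dvdn // => /negP; apply.
by apply: dvdn_trans d2k; rewrite dvdn_exp2r.
Qed.

(** Both sides have the same valuation at every prime [q]: if [q] divides [k], it is some [p i] by
    [k_dvd], and injectivity makes it occur exactly once on the right; otherwise both valuations are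
    0. *)
Lemma prod_prime_divisors_logn_le1 (t : nat) (p alpha : 'I_t -> nat)
    (k : nat) :
    (forall i, prime (p i)) -> injective p ->
    (0 < k)%N -> (forall q, logn q k <= 1)%N ->
    (k %| \prod_(i < t) p i ^ alpha i)%N ->
  k = (\prod_(i < t | (p i %| k)%N) p i)%N.
Proof.
move=> p_pr p_inj k_gt0 k_le1 k_dvd; apply: eqn_from_log => // [|q].
  by rewrite prodn_cond_gt0 // => i _; rewrite prime_gt0.
rewrite logn_prod => [|i _]; last exact: prime_gt0.
under eq_bigr => i _ do rewrite logn_prime //.
have [/andP[q_pr qk] | qk] := boolP (prime q && (q %| k)%N).
  have : (q %| \prod_(i < t) p i ^ alpha i)%N by apply: dvdn_trans qk k_dvd.
  rewrite Euclid_dvd_prod // big_has => /hasP[i _].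
  rewrite Euclid_dvdX // dvdn_prime2 // => /andP[/eqP q_pi _].
  rewrite (bigD1 i) /= -?q_pi // eqxx big1 => [|l /andP[_ l_neq]].
    by apply/eqP; rewrite addn0 eqn_leq k_le1 -pfactor_dvdn.
  by rewrite q_pi (inj_eq p_inj) eq_sym (negPf l_neq).
rewrite big1 => [|i pik].
  by rewrite lognE k_gt0; move: qk; case: (prime q) => //= /negPf->.
by case: eqP => // q_pi; rewrite q_pi p_pr pik in qk.
Qed.

Theorem lemma2p11 (t : nat) (p alpha : 'I_t -> nat) (m : nat)
    (p_prime : forall i, prime (p i)) (p_inj : injective p)
    (alpha_gt0 : forall i, (0 < alpha i)%N)
    (m_fact : m = (\prod_(i < t) p i ^ alpha i)%N)
    (zeta : algC) (zeta_prim : m.-primitive_root zeta)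
    (X : ngring m) (X_vsum : vsum zeta X)
    (k : nat) (X_cexp : c_exponent zeta X k) :
  squarefree k /\ exists I : {set 'I_t}, k = (\prod_(i in I) p i)%N.
Proof.
(* For a decomposition realising [k], divisibility of [m] and the bound on valuations pass from the
   reduced exponents of the parts to their lcm. *)
have [[n [Y [[_ Y_min] [r Y_r k_lcm]]]] _] := X_cexp.
have m_gt0 := prim_order_gt0 zeta_prim.
have k_dvd : (k %| m)%N.
  rewrite k_lcm; apply/dvdn_biglcmP => i _.
  exact: vsum_reduced_exponent_dvd (Y_r i).
have k_gt0 := dvdn_gt0 m_gt0 k_dvd.
have zeta_neq0 : zeta != 0.
  apply: contra_eq_neq (prim_expr_order zeta_prim) => ->.
  by rewrite expr0n gtn_eqF // eq_sym oner_neq0.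
have k_le1 q : (logn q k <= 1)%N.
  rewrite k_lcm; apply: logn_biglcm_le => i; first by have [[]] := Y_r i.
  exact: minimal_vsum_reduced_exponent_logn (Y_min i).2 (Y_r i).
split; first exact: squarefree_logn_le1.
exists [set i | (p i %| k)%N]; under eq_bigl do rewrite inE.
by apply: (@prod_prime_divisors_logn_le1 _ p alpha); rewrite -?m_fact.
Qed.
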